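(* There is a universal constant $c_2>0$ such that the following holds. Fix any $\varepsilon\in(0,1)$ and $\delta\in(0,c_2\varepsilon]$, let $h\in\mathbb{N}$ be sufficiently large, and let $d:=\lceil\delta h\rceil$. Let $N$ be the largest integer satisfying $h\ge d\log_{\sqrt d}(N/d)$, and let $R_{h,N}$ be an $h\times N$ matrix with i.i.d. uniform $\pm1$ entries. Then with probability $1-o(1)$ (as $h\to\infty$), $d_2(\ker(R_{h,N}))\ge 2(1-\varepsilon)d$.
   Context: For a subspace $C\subseteq\mathbb{R}^N$, the order-2 Hamming weight $d_2(C)$ is the minimum of $|\mathrm{supp}(u_1)\cup\mathrm{supp}(u_2)|$ over all pairs of linearly independent vectors $u_1,u_2\in C$, where $\mathrm{supp}(u)$ is the set of nonzero coordinates of $u$. *)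

(* Defs.v *)
From HB Require Import structures.
From mathcomp Require Import all_boot all_order all_algebra.
From mathcomp Require Import boolp reals exp.
Set Implicit Arguments. Unset Strict Implicit. Unset Printing Implicit Defensive.
Import Order.TTheory GRing.Theory Num.Theory.
Local Open Scope ring_scope.

Definition supp (R : ringType) (N : nat) (u : 'cV[R]_N) : {set 'I_N} :=
  [set i | u i ord0 != 0].

Definition in_ker (R : ringType) (h N : nat) (A : 'M[R]_(h, N)) (x : 'cV[R]_N) : Prop :=
  A *m x = 0.

Definition lin_indep2 (R : ringType) (N : nat) (u1 u2 : 'cV[R]_N) : Prop :=
  forall a b : R, a *: u1 + b *: u2 = 0 -> a = 0 /\ b = 0.

(* "d_2(ker A) >= k": every pair of linearly independent kernel vectors has
   union of supports of size >= k (d_2 is the min of these sizes; min of the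
   empty set is +infinity, so the bound holds vacuously if dim ker < 2). *)
Definition d2_ker_ge (R : realType) (h N : nat) (A : 'M[R]_(h, N)) (k : R) : Prop :=
  forall u1 u2 : 'cV[R]_N, in_ker A u1 -> in_ker A u2 -> lin_indep2 u1 u2 ->
    k <= (#|supp u1 :|: supp u2|)%:R.

Definition pm1_mx (R : ringType) (h N : nat) (M : 'M[bool]_(h, N)) : 'M[R]_(h, N) :=
  \matrix_(i, j) (if M i j then 1 else -1).

(* probability, for an h x N matrix with i.i.d. uniform +-1 entries, that
   d_2(ker) >= k : uniform measure on the 2^(hN) sign patterns *)
Definition prob_d2_ge (R : realType) (h N : nat) (k : R) : R :=
  (#|[set M : 'M[bool]_(h, N) | `[< d2_ker_ge (pm1_mx R M) k >] ]|)%:R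
  / (2 ^ (h * N))%:R.

Definition logb (R : realType) (b x : R) : R := ln x / ln b.

Definition largest_N (R : realType) (h d N : nat) : Prop :=
  [/\ (0 < N)%N,
      (d%:R * logb (Num.sqrt (d%:R : R)) (N%:R / d%:R) <= h%:R)
    & forall N' : nat, (0 < N')%N ->
        d%:R * logb (Num.sqrt (d%:R : R)) (N'%:R / d%:R) <= (h%:R : R) -> (N' <= N)%N].

(* Main.v *)
(** A union bound over [d_1] and [d_2]. Write [D = (1 - eps) d]. With high probability no
    nonzero kernel vector has support smaller than [D]; given this, a 2-dimensional kernel
    subspace supported on [m < 2 D] coordinates meets every line of coordinate functionals in
    at most [m / 2] coordinates, so at least [m / 4] disjoint pairs of coordinates are
    independent on it.

    A random sign row kills a fixed vector of support [t] with probability at most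
    [sqrt (2 / t)], and a fixed subspace with [k] independent pairs with probability at most
    [2 / k]. Both come from one dyadic Hoelder inequality for the number of signings of a
    family of vectors with prescribed sum: iterating Cauchy-Schwarz replaces different
    blocks of vectors by copies of a single block, which is then counted by central binomials.

    The subspace is not fixed in advance, but on a support of size [t] some [t] rows of the
    matrix already cut out its kernel, and the other [h - t] rows must be orthogonal to it.
    Hence an event of support size [t] and row probability [p] has probability at most
    [(N h) ^ t p ^ (h - t)]. Since [(N / d) ^ d <= d ^ (h / 2)], this tends to 0, using [p <= 1/2]
    instead of [sqrt (2 / t)] when [t] is below [h / ln h] up to a constant. *)
Require Import Defs.
From HB Require Import structures.
From mathcomp Require Import all_boot all_order all_algebra.
From mathcomp Require Import boolp reals exp.
From mathcomp Require Import zify ring lra.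
Set Implicit Arguments. Unset Strict Implicit. Unset Printing Implicit Defensive.
Import Order.TTheory GRing.Theory Num.Theory.
Local Open Scope ring_scope.

(** * Counting the signings of a family of vectors with a prescribed sum *)

Section SignedSums.
Variable V : zmodType.
Implicit Types (s : seq V) (b v x : V).

Fixpoint signed_sums s : seq V :=
  if s is v :: s' then
    [seq x + v | x <- signed_sums s'] ++ [seq x - v | x <- signed_sums s']
  else [:: 0].

(** Since [signed_sums] has one entry per choice of signs, this divided by [2 ^ size s] is the
    probability that a random signed sum equals [b]. *)
Definition nsign s b : nat := count_mem b (signed_sums s).

Lemma nsign_nil b : nsign [::] b = (b == 0) :> nat.
Proof. by rewrite /nsign /= addn0 eq_sym. Qed.

Lemma nsign_cons v s b : nsign (v :: s) b = (nsign s (b - v)%R + nsign s (b + v)%R)%N.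
Proof.
rewrite /nsign /= count_cat !count_map; congr addn; apply: eq_count => x /=.
  by rewrite eq_sym -subr_eq eq_sym.
by rewrite subr_eq.
Qed.

Lemma nsign_cat s1 s2 b :
  nsign (s1 ++ s2) b = (\sum_(x <- signed_sums s1) nsign s2 (b - x)%R)%N.
Proof.
elim: s1 b => [|v s1 IH] b /=; first by rewrite big_seq1 subr0.
rewrite nsign_cons !IH big_cat !big_map /=; congr addn; apply: eq_bigr => x _;
  by congr nsign; rewrite !opprD ?opprK addrAC addrA.
Qed.

Lemma nsignN s b : nsign s (- b) = nsign s b.
Proof.
elim: s b => [|v s IH] b; first by rewrite !nsign_nil oppr_eq0.
by rewrite !nsign_cons -opprD [- b + v]addrC -opprB !IH addnC.
Qed.

Lemma nsign_catCA s1 v s2 b : nsign (s1 ++ v :: s2) b = nsign (v :: s1 ++ s2) b.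
Proof.
elim: s1 b => //= w s1 IH b.
rewrite nsign_cons !IH !nsign_cons addnACA.
by rewrite [b - w - v]addrAC [b + w - v]addrAC [b - w + v]addrAC [b + w + v]addrAC.
Qed.

Lemma nsign_perm s1 s2 b : perm_eq s1 s2 -> nsign s1 b = nsign s2 b.
Proof.
elim: s1 s2 b => [|v s1 IH] s2 b eq12.
  by rewrite perm_sym in eq12; rewrite (perm_nilP eq12).
have /path.splitPr E : v \in s2 by rewrite -(perm_mem eq12) mem_head.
case: E eq12 => p1 p2; rewrite perm_sym (perm_catCA p1 [:: v] p2) /= perm_cons perm_sym => /IH eq12.
by rewrite nsign_catCA !nsign_cons !eq12.
Qed.

(** Each choice of signs on [s2] only shifts the target for [s1], where the bound is uniform. *)
Lemma nsign_catl_le s1 s2 c : (forall b, nsign s1 b <= c)%N ->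
  forall b, (nsign (s1 ++ s2) b <= c * 2 ^ size s2)%N.
Proof.
move=> le_c; elim: s2 => [|v s2 IH] b /=; first by rewrite cats0 muln1.
rewrite nsign_catCA nsign_cons expnS mul2n -addnn mulnDr; exact: leq_add.
Qed.

(** Grouping by value over a larger list [r] lets two different lists be summed over a common index
    set, as Cauchy-Schwarz requires. *)
Lemma sum_undup_count (s r : seq V) (F : V -> nat) : {subset s <= r} ->
  (\sum_(x <- undup r) count_mem x s * F x = \sum_(x <- s) F x)%N.
Proof.
move=> sr; transitivity (\sum_(x <- undup r) \sum_(y <- s | y == x) F y)%N.
  apply: eq_bigr => x _; rewrite (eq_bigr (fun=> F x)) => [|y /eqP-> //].
  by rewrite big_const_seq iter_addn_0 mulnC.
rewrite (exchange_big_dep predT) //= big_seq [RHS]big_seq; apply: eq_bigr => y ys.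
rewrite (eq_bigl (pred1 y)) => [|x]; last by rewrite /= eq_sym.
rewrite (big_rem y) ?mem_undup ?sr //= eqxx big1_seq ?addn0 // => x.
by rewrite mem_rem_uniq ?undup_uniq // => /andP[/eqP-> ]; rewrite !inE eqxx.
Qed.

Lemma nsign_double s : nsign (s ++ s) 0 = (\sum_(x <- signed_sums s) nsign s x)%N.
Proof. by rewrite nsign_cat; apply: eq_bigr => x _; rewrite sub0r nsignN. Qed.

Lemma sum_Cauchy_Schwarz (T : Type) (r : seq T) (f g : T -> nat) :
  ((\sum_(x <- r) f x * g x) ^ 2 <= (\sum_(x <- r) f x ^ 2) * (\sum_(x <- r) g x ^ 2))%N.
Proof.
rewrite -mulnn !big_distrlr /= -(leq_pmul2l (m := 2)) //.
set L := (\sum_(x <- r) _)%N; set D := (\sum_(x <- r) _)%N.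
(* Doubled and symmetrized, the inequality holds term by term: [2ab <= a^2 + b^2] with
   [a = f x * g y] and [b = f y * g x]. *)
have -> : (2 * D = \sum_(x <- r) \sum_(y <- r) (f x ^ 2 * g y ^ 2 + f y ^ 2 * g x ^ 2))%N.
  under eq_bigr do rewrite big_split /=.
  by rewrite big_split /= [X in (_ + X)%N]exchange_big /= addnn mul2n.
rewrite /L big_distrr; apply: leq_sum => x _; rewrite big_distrr; apply: leq_sum => y _ /=.
by rewrite mulnACA [(g x * g y)%N]mulnC mulnACA -!expnMn; exact: nat_Cauchy.
Qed.

(** The left count is the convolution of [nsign s1 x] and [nsign s2 (b - x)] over distinct values
    [x]. By sign symmetry the sums of squares of the two factors are the counts for the doubled
    lists at 0. *)
Lemma nsign_Cauchy_Schwarz s1 s2 b :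
  (nsign (s1 ++ s2) b ^ 2 <= nsign (s1 ++ s1) 0 * nsign (s2 ++ s2) 0)%N.
Proof.
set s2' := [seq b - x | x <- signed_sums s2].
have cnt2 x : count_mem x s2' = nsign s2 (b - x).
  rewrite /s2' count_map; apply: eq_count => y /=.
  by rewrite subr_eq eq_sym [RHS]eq_sym subr_eq addrC.
set r := signed_sums s1 ++ s2'.
have s1r : {subset signed_sums s1 <= r} by move=> x xs; rewrite mem_cat xs.
have s2r : {subset s2' <= r} by move=> x xs; rewrite mem_cat xs orbT.
rewrite nsign_cat -(sum_undup_count _ s1r) !nsign_double -(sum_undup_count _ s1r).
have -> : (\sum_(x <- signed_sums s2) nsign s2 x = \sum_(x <- s2') nsign s2 (b - x)%R)%N.
  by rewrite big_map; apply: eq_bigr => x _; rewrite opprB addrC subrK.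
rewrite -(sum_undup_count _ s2r).
apply: leq_trans (sum_Cauchy_Schwarz _ _ _) _; rewrite leq_mul //.
by under [leqRHS]eq_bigr do rewrite cnt2 mulnn.
Qed.

Definition repeat k s : seq V := flatten (nseq k s).

Lemma perm_repeat_double k s : perm_eq (repeat k (s ++ s)) (repeat (k * 2) s).
Proof.
rewrite muln2 -addnn; elim: k => // k IH; rewrite addSn addnS /repeat /= -catA.
by rewrite !perm_cat2l.
Qed.

Lemma perm_flatten_double (Bs : seq (seq V)) :
  perm_eq (flatten Bs ++ flatten Bs) (flatten [seq B ++ B | B <- Bs]).
Proof.
elim: Bs => //= B Bs IH.
by rewrite -!catA perm_cat2l perm_catCA perm_cat2l.
Qed.

(* A dyadic Hölder inequality, by iterating Cauchy-Schwarz. *)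
Lemma nsign_flatten_le j c (Bs : seq (seq V)) b : size Bs = (2 ^ j.+1)%N ->
  (forall B, B \in Bs -> nsign (repeat (2 ^ j.+1) B) 0 <= c)%N ->
  (nsign (flatten Bs) b <= c)%N.
Proof.
elim: j Bs b => [|j IH] Bs b szB le_c.
  case: Bs szB le_c => [|B1 [|B2 []]] // _ le_c; rewrite /= cats0 -(leq_exp2r _ _ (e := 2)) //.
  apply: leq_trans (nsign_Cauchy_Schwarz _ _ _) _; rewrite -mulnn.
  by have := leq_mul (le_c B1 _) (le_c B2 _); rewrite /repeat /= !cats0; apply; rewrite !inE eqxx ?orbT.
(* A doubled half is, up to order, a family of [2 ^ j.+1] blocks [B ++ B]. Repeating such a block
   [2 ^ j.+1] times repeats [B] twice as often, so the induction hypothesis applies with the same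
   [c]. *)
have half Cs : {subset Cs <= Bs} -> size Cs = (2 ^ j.+1)%N ->
    (nsign (flatten Cs ++ flatten Cs) 0 <= c)%N.
  move=> CB szC; rewrite (nsign_perm _ (perm_flatten_double _)).
  apply: IH => [|_ /mapP[B CsB ->]]; first by rewrite size_map.
  by rewrite (nsign_perm _ (perm_repeat_double _ _)) -expnSr; exact/le_c/CB.
rewrite -(cat_take_drop (2 ^ j.+1) Bs) flatten_cat -(leq_exp2r _ _ (e := 2)) //.
apply: leq_trans (nsign_Cauchy_Schwarz _ _ _) _; rewrite -mulnn.
apply: leq_mul; apply: half.
- by move=> x; exact: mem_take.
- by rewrite size_takel // szB leq_exp2l.
- by move=> x; exact: mem_drop.
- by rewrite size_drop szB [in X in (X - _)%N]expnS mul2n -addnn addnK.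
Qed.

Lemma card_signs_le n (v : 'I_n -> V) b :
  (#|[set e : {ffun 'I_n -> bool} | (\sum_i (if e i then v i else - v i))%R == b]|
     <= nsign [seq v i | i <- enum 'I_n] b)%N.
Proof.
elim: n v b => [|n IH] v b.
  rewrite enum_ord0 nsign_nil.
  case: eqP => [_|nb0]; last first.
    by rewrite leqn0 cards_eq0; apply/eqP/setP=> e; rewrite !inE big_ord0 eq_sym; apply/eqP.
  by apply: leq_trans (max_card _) _; rewrite card_ffun card_ord.
rewrite enum_ordSl /= nsign_cons -map_comp.
set A := [set _ | _].
rewrite -(cardsID [set e : {ffun 'I_n.+1 -> bool} | e ord0] A).
pose tl (e : {ffun 'I_n.+1 -> bool}) := [ffun i : 'I_n => e (lift ord0 i)].
have inj_tl a (B : {set {ffun 'I_n.+1 -> bool}}) :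
    (forall e, e \in B -> e ord0 = a) -> {in B &, injective tl}.
  move=> Ba e e' Be Be' /ffunP eq_t; apply/ffunP => i.
  case: (unliftP ord0 i) => [i'|] ->; last by rewrite !Ba.
  by have := eq_t i'; rewrite !ffunE.
apply: leq_add.
  rewrite -(card_in_imset (inj_tl true _ _)) => [|e]; last by rewrite !inE => /andP[_].
  apply: leq_trans (IH _ _); apply/subset_leq_card/subsetP => _ /imsetP[e + ->].
  rewrite !inE big_ord_recl => /andP[/eqP <- e0]; apply/eqP.
  by rewrite e0 addrC addKr; apply: eq_bigr => i _; rewrite ffunE.
rewrite -(card_in_imset (inj_tl false _ _)) => [|e]; last first.
  by rewrite !inE => /andP[/negbTE].
apply: leq_trans (IH _ _); apply/subset_leq_card/subsetP => _ /imsetP[e + ->].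
rewrite !inE big_ord_recl => /andP[/negbTE e0 /eqP <-]; apply/eqP.
by rewrite e0 addrAC addNr add0r; apply: eq_bigr => i _; rewrite ffunE.
Qed.

End SignedSums.

(** * Central binomial coefficients *)

Lemma central_bin_succ n : (n.+1 * 'C(2 * n.+1, n.+1) = 2 * (2 * n).+1 * 'C(2 * n, n))%N.
Proof.
have e1 := mul_bin_diag (2 * n).+2 n; have e2 := mul_bin_diag (2 * n).+1 n.
have e3 : 'C((2 * n).+1, n) = 'C((2 * n).+1, n.+1).
  by rewrite -(@bin_sub _ n.+1); [congr binomial; lia|lia].
rewrite /= e3 in e1 e2; have -> : (2 * n.+1 = (2 * n).+2)%N by lia.
rewrite -e1; nia.
Qed.

Lemma central_bin_le n : ('C(2 * n, n) ^ 2 * (2 * n).+1 <= 4 ^ (2 * n))%N.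
Proof.
elim: n => // n IH; have := central_bin_succ n.
set c := 'C(2 * n, n) in IH *; set c' := 'C(2 * n.+1, n.+1) => ec.
rewrite -(leq_pmul2l (m := n.+1 ^ 2)) // mulnA -expnMn ec !expnMn.
have -> : (4 ^ (2 * n.+1) = 16 * 4 ^ (2 * n))%N by rewrite mulnS expnD.
have h2 : (4 * (2 * n).+1 * (2 * n.+1).+1 <= 16 * n.+1 ^ 2)%N by nia.
have := leq_mul h2 IH; nia.
Qed.

(** * Signings of nonzero vectors and of independent pairs *)

Section TorsionFree.
Variables (R : numFieldType) (V : lmodType R).
Implicit Types (v w b : V).

Lemma nsign_nseq_far v n m : v != 0 -> (n < m)%N -> nsign (nseq n v) (v *+ m) = 0%N.
Proof.
move=> v0; elim: n m => [|n IH] m nm.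
  by rewrite nsign_nil -scaler_nat scaler_eq0 (negbTE v0) orbF pnatr_eq0; case: m nm.
case: m nm => // m nm; rewrite /= nsign_cons -mulrSr [v *+ m.+1]mulrSr addrK !IH //; lia.
Qed.

Lemma nsign_nseq_bin v i j : v != 0 ->
  nsign (nseq (i + j) v) (v *+ i - v *+ j) = 'C(i + j, i).
Proof.
move=> v0; move eqn: (i + j)%N => n; elim: n i j eqn => [|n IH] i j eij.
  have [-> ->] : i = 0%N /\ j = 0%N by lia.
  by rewrite subrr nsign_nil eqxx bin0.
rewrite /= nsign_cons; case: i j eij => [|i] [|j] eij.
- by [].
- rewrite sub0r -opprD -mulrSr nsignN nsign_nseq_far //; last by lia.
  rewrite mulrSr opprD addrNK -[- _]sub0r -(mulr0n v) IH ?bin0 //; lia.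
- rewrite subr0 mulrSr addrK -mulrSr -mulrSr (@nsign_nseq_far v n i.+2) ?addn0; [|by []|lia].
  have en : n = i by lia.
  have := IH i 0%N; rewrite mulr0n subr0 addn0 => ->; last by lia.
  by rewrite en !binn.
- rewrite binS addnC; congr addn.
    have <- := IH i.+1 j; last by lia.
    by congr nsign; rewrite [v *+ j.+1]mulrSr opprD addrA addrNK.
  have <- := IH i j.+1; last by lia.
  by congr nsign; rewrite [v *+ i.+1]mulrSr addrAC addrK.
Qed.

Lemma nsign_nseq_central v n : v != 0 -> nsign (nseq (2 * n) v) 0 = 'C(2 * n, n).
Proof. by move=> v0; rewrite mul2n -addnn -(nsign_nseq_bin n n v0) subrr. Qed.

Lemma signed_sums_nseq v n b : b \in signed_sums (nseq n v) -> exists a : R, b = a *: v.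
Proof.
elim: n b => [|n IH] b /=; first by rewrite inE => /eqP->; exists 0; rewrite scale0r.
rewrite mem_cat => /orP[] /mapP[x /IH[a ->] ->].
  by exists (a + 1); rewrite scalerDl scale1r.
by exists (a - 1); rewrite scalerBl scale1r.
Qed.

(** The lines through [v] and [w] meet only in 0. A zero vector is allowed; nonvanishing is asked
    for separately. *)
Definition indep2 v w := forall a b : R, a *: v = b *: w -> a *: v = 0.

(** By independence, a vanishing signed sum already vanishes on the copies of [v] and on the copies
    of [w]. *)
Lemma nsign_nseq_indep v w k : indep2 v w ->
  (nsign (nseq k v ++ nseq k w) 0 <= nsign (nseq k v) 0 * nsign (nseq k w) 0)%N.
Proof.
move=> vw; rewrite nsign_cat /nsign -[X in (_ <= X * _)%N]sum1_count big_distrl /=.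
rewrite [leqRHS]big_mkcond /= big_seq [leqRHS]big_seq leq_sum // => x /signed_sums_nseq[a xE].
case: eqP => [->|/eqP x0]; first by rewrite subr0 mul1n.
rewrite leqn0 -leqn0 leqNgt -has_count has_pred1; apply/negP => /signed_sums_nseq[b].
rewrite sub0r => /(congr1 -%R); rewrite opprK xE -scaleNr => /vw av.
by rewrite xE av eqxx in x0.
Qed.

Lemma repeat1 k v : repeat k [:: v] = nseq k v.
Proof. by elim: k => // k IH; rewrite /repeat /=; congr cons. Qed.

Lemma perm_repeat2 k v w : perm_eq (repeat k [:: v; w]) (nseq k v ++ nseq k w).
Proof.
elim: k => // k IH; rewrite /repeat /= perm_cons perm_sym.
by rewrite (perm_catCA (nseq k v) [:: w] _) /= perm_cons perm_sym.
Qed.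

(** A Littlewood-Offord bound for a power of two of vectors, from the Hoelder inequality with
    singleton blocks. *)
Lemma nsign_singles j (vs : seq V) b : size vs = (2 ^ j.+1)%N ->
  (forall v, v \in vs -> v != 0) -> (nsign vs b <= 'C(2 ^ j.+1, 2 ^ j))%N.
Proof.
move=> szv nz; have -> : vs = flatten [seq [:: v] | v <- vs].
  by elim: (vs) => //= v s {1}->.
apply: (nsign_flatten_le (j := j)); first by rewrite size_map.
by move=> _ /mapP[v /nz v0 ->]; rewrite repeat1 expnS nsign_nseq_central.
Qed.

(** With independent pairs as blocks, each repeated block splits into two one-vector counts, whence
    the square. *)
Lemma nsign_pairs j (ps : seq (V * V)) b : size ps = (2 ^ j.+1)%N ->
  (forall p, p \in ps -> [/\ p.1 != 0, p.2 != 0 & indep2 p.1 p.2]) ->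
  (nsign (flatten [seq [:: p.1; p.2] | p <- ps]) b <= 'C(2 ^ j.+1, 2 ^ j) ^ 2)%N.
Proof.
move=> szp nz; apply: (nsign_flatten_le (j := j)); first by rewrite size_map.
move=> _ /mapP[p /nz[p1 p2 p12] ->]; rewrite (nsign_perm _ (perm_repeat2 _ _ _)).
apply: leq_trans (nsign_nseq_indep _ p12) _.
by rewrite expnS !nsign_nseq_central // mulnn.
Qed.

End TorsionFree.

(** A maximal matching: each new element is matched with a leftover neighbour if there is one, and
    otherwise joins the leftovers, which stay pairwise unrelated. *)
Lemma greedy_pairing (T : eqType) (e : rel T) (s : seq T) : symmetric e -> irreflexive e ->
  exists ps : seq (T * T), exists r : seq T,
    [/\ perm_eq s (flatten [seq [:: p.1; p.2] | p <- ps] ++ r),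
        forall p, p \in ps -> e p.1 p.2
      & forall x y, x \in r -> y \in r -> ~~ e x y].
Proof.
move=> sym_e irr_e; elim: s => [|v s [ps [r [eqs eps er]]]].
  by exists [::], [::].
have [/hasP[w rw evw]|/hasPn nev] := boolP (has (e v) r).
  exists ((v, w) :: ps), (rem w r); split=> [|p|x y /mem_rem xr /mem_rem yr].
  - rewrite /= perm_cons (perm_trans eqs) // perm_sym -cat1s perm_catCA perm_cat2l /=.
    by rewrite perm_sym perm_to_rem.
  - by rewrite inE => /predU1P[-> //|/eps].
  - exact: er.
exists ps, (v :: r); split=> // [|x y].
  by rewrite perm_sym (perm_catCA _ [:: v] r) /= perm_cons perm_sym.
rewrite !inE => /predU1P[->|xr] /predU1P[->|yr].
- by rewrite irr_e.
- exact: nev.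
- by rewrite sym_e nev.
- exact: er.
Qed.

(** * Sign rows orthogonal to a fixed matrix *)

Section Orthogonal.
Variables (R : realType) (N q : nat).
Implicit Types (U : 'M[R]_(N, q)) (s : seq 'I_N).

Definition orth_signs U : {set 'rV[bool]_N} := [set r | pm1_mx R r *m U == 0].

Lemma card_orth_signs U : (#|orth_signs U| <= nsign [seq row i U | i <- enum 'I_N] 0)%N.
Proof.
apply: leq_trans (card_signs_le _ _).
pose f (r : 'rV[bool]_N) : {ffun 'I_N -> bool} := [ffun i => r ord0 i].
have inj_f : injective f.
  by move=> r r' /ffunP eqr; apply/rowP => i; have := eqr i; rewrite !ffunE.
rewrite -(card_imset _ inj_f); apply/subset_leq_card/subsetP => _ /imsetP[r + ->].
rewrite !inE mulmx_sum_row => /eqP U0; apply/eqP; rewrite -[RHS]U0; apply: eq_bigr => i _.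
by rewrite ffunE mxE; case: ifP; rewrite ?scale1r ?scaleN1r.
Qed.

Lemma card_orth_signs_sub U s c : uniq s ->
  (forall b, nsign [seq row i U | i <- s] b <= c)%N ->
  (#|orth_signs U| * 2 ^ size s <= c * 2 ^ N)%N.
Proof.
move=> us le_c; pose s' := [seq i <- enum 'I_N | i \notin s].
have eqe : perm_eq (enum 'I_N) (s ++ s').
  rewrite uniq_perm ?enum_uniq // => [|i]; last first.
    by rewrite mem_enum mem_cat mem_filter mem_enum andbT orbN.
  rewrite cat_uniq us filter_uniq ?enum_uniq //= andbT.
  by apply/hasPn => i; rewrite mem_filter => /andP[].
have szN : (size s' + size s = N)%N.
  by rewrite addnC -size_cat -(perm_size eqe) size_enum_ord.
rewrite -[X in (_ <= _ * 2 ^ X)%N]szN expnD mulnA leq_mul2r; apply/orP; right.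
apply: leq_trans (card_orth_signs U) _.
rewrite (nsign_perm _ (perm_map (fun i => row i U) eqe)) map_cat.
by have := nsign_catl_le [seq row i U | i <- s'] le_c 0; rewrite size_map.
Qed.

(** Once the other signs are chosen, at most one sign at [i] gives sum 0. *)
Lemma card_orth_signs_half U i : row i U != 0 -> (2 * #|orth_signs U| <= 2 ^ N)%N.
Proof.
move=> Ui; have := @card_orth_signs_sub U [:: i] 1; rewrite mulnC mul1n; apply => // b /=.
rewrite nsign_cons !nsign_nil; do 2 case: eqP => //=.
move=> /eqP; rewrite addr_eq0 => /eqP->; move/eqP.
by rewrite -opprD oppr_eq0 -mulr2n -scaler_nat scaler_eq0 pnatr_eq0 (negbTE Ui).
Qed.

(** The row probability [sqrt (2 / size s)]. Only the first [k] rows are used, [k] the largest power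
    of two up to [size s]; as [size s <= 2 (k + 1)], the rounding costs a factor 2 after
    squaring. *)
Lemma card_orth_signs_single U s : uniq s -> (1 < size s)%N ->
  (forall i, i \in s -> row i U != 0) ->
  (#|orth_signs U| ^ 2 * size s <= 2 * 4 ^ N)%N.
Proof.
move=> us s1 nz; set Z := #|_|.
have /andP[ts st] := trunc_log_bounds (isT : 1 < 2)%N (ltnW s1).
have: (0 < trunc_log 2 (size s))%N by rewrite trunc_log_gt0.
case: (trunc_log 2 (size s)) ts st => // j ts st _.
pose s' := take (2 ^ j.+1) s.
have szs' : size s' = (2 ^ j.+1)%N by rewrite size_takel.
have Zle : (Z * 2 ^ (2 ^ j.+1) <= 'C(2 ^ j.+1, 2 ^ j) * 2 ^ N)%N.
  rewrite -{1}szs'; apply: card_orth_signs_sub (take_uniq _ us) _ => b.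
  by apply: nsign_singles => [|v /mapP[i /mem_take/nz ? ->]] //; rewrite size_map.
have cb := central_bin_le (2 ^ j); rewrite -expnS in cb.
set k := (2 ^ j.+1)%N in cb Zle st; have k0 : (0 < 4 ^ k)%N by rewrite expn_gt0.
rewrite -(leq_pmul2r k0).
have sk : (size s <= 2 * k.+1)%N by move: st; rewrite expnS -/k; lia.
have e4 n : (4 ^ n = 2 ^ n * 2 ^ n)%N by rewrite -expnMn.
apply: (@leq_trans (Z ^ 2 * (2 * k.+1) * 4 ^ k)); first by rewrite leq_mul2r leq_mul2l sk !orbT.
have := leq_mul Zle Zle; rewrite mulnACA -e4 mulnn => Z2.
apply: (@leq_trans (2 * k.+1 * (('C(k, 2 ^ j) * 2 ^ N) * ('C(k, 2 ^ j) * 2 ^ N)))).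
  by rewrite mulnAC mulnC leq_mul2l Z2 orbT.
rewrite [(_ * 2 ^ N * _)%N]mulnACA -e4 mulnn mulnA.
have -> : (2 * k.+1 * 'C(k, 2 ^ j) ^ 2 * 4 ^ N = (2 * 4 ^ N) * ('C(k, 2 ^ j) ^ 2 * k.+1))%N by lia.
by rewrite leq_mul2l cb orbT.
Qed.

(** The same rounding to a power of two; the squared binomial now gives probability [2 / size ps]
    directly. *)
Lemma card_orth_signs_pairs U (ps : seq ('I_N * 'I_N)) :
  uniq (flatten [seq [:: p.1; p.2] | p <- ps]) -> (1 < size ps)%N ->
  (forall p, p \in ps -> [/\ row p.1 U != 0, row p.2 U != 0 & indep2 (row p.1 U) (row p.2 U)]) ->
  (#|orth_signs U| * size ps <= 2 * 2 ^ N)%N.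
Proof.
move=> us s1 nz; set Z := #|_|.
have /andP[ts st] := trunc_log_bounds (isT : 1 < 2)%N (ltnW s1).
have: (0 < trunc_log 2 (size ps))%N by rewrite trunc_log_gt0.
case: (trunc_log 2 (size ps)) ts st => // j ts st _.
pose ps' := take (2 ^ j.+1) ps.
have szs' : size ps' = (2 ^ j.+1)%N by rewrite size_takel.
have Zle : (Z * 2 ^ (2 * 2 ^ j.+1) <= 'C(2 ^ j.+1, 2 ^ j) ^ 2 * 2 ^ N)%N.
  have <- : size (flatten [seq [:: p.1; p.2] | p <- ps']) = (2 * 2 ^ j.+1)%N.
    by rewrite -szs'; elim: (ps') => //= p r ->; rewrite mulnS.
  apply: card_orth_signs_sub => [|b].
    move: us; rewrite -{1}(cat_take_drop (2 ^ j.+1) ps) map_cat flatten_cat cat_uniq.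
    by case/and3P.
  rewrite map_flatten -map_comp.
  pose f (p : 'I_N * 'I_N) := (row p.1 U, row p.2 U).
  rewrite (@eq_map _ _ _ ((fun p : 'rV[R]_q * 'rV[R]_q => [:: p.1; p.2]) \o f)) // map_comp.
  apply: nsign_pairs; first by rewrite size_map.
  by move=> _ /mapP[p /mem_take/nz ? ->].
have cb := central_bin_le (2 ^ j); rewrite -expnS in cb.
set k := (2 ^ j.+1)%N in cb Zle st; have k0 : (0 < 4 ^ k)%N by rewrite expn_gt0.
rewrite mulnC expnM in Zle; change (2 ^ 2)%N with 4%N in Zle.
rewrite -(leq_pmul2r k0).
have sk : (size ps <= 2 * k.+1)%N by move: st; rewrite expnS -/k; lia.
apply: (@leq_trans (Z * (2 * k.+1) * 4 ^ k)); first by rewrite leq_mul2r leq_mul2l sk !orbT.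
apply: (@leq_trans (2 * k.+1 * ('C(k, 2 ^ j) ^ 2 * 2 ^ N))).
  by rewrite mulnAC mulnC leq_mul2l [(Z * _)%N]mulnC Zle orbT.
have -> : (2 * k.+1 * ('C(k, 2 ^ j) ^ 2 * 2 ^ N) = (2 * 2 ^ N) * ('C(k, 2 ^ j) ^ 2 * k.+1))%N by lia.
by rewrite leq_mul2l cb orbT.
Qed.

End Orthogonal.

(** * Counting sign matrices with a kernel element of bounded support *)

Lemma card_mx_rows_le h N (A : 'I_h -> {set 'rV[bool]_N}) :
  (#|[set M : 'M[bool]_(h, N) | [forall i, row i M \in A i]]| <= \prod_i #|A i|)%N.
Proof.
pose f (M : 'M[bool]_(h, N)) : {ffun 'I_h -> 'rV[bool]_N} := [ffun i => row i M].
have inj_f : injective f.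
  by move=> M M' /ffunP eqM; apply/row_matrixP => i; have := eqM i; rewrite !ffunE.
have -> : (\prod_i #|A i| = #|family (fun i => mem (A i))|)%N.
  by rewrite card_family foldrE big_map big_enum.
rewrite -(card_imset _ inj_f); apply/subset_leq_card/subsetP => _ /imsetP[M + ->].
by rewrite inE => /forallP MA; apply/familyP => i; rewrite ffunE; exact: MA.
Qed.

(** Coding small sets as images of functions on ['I_t] lets a union bound run over [n.+1 ^ t]
    functions; [ord0] pads the missing values. *)
Lemma subset_imset_ord n t (S : {set 'I_n.+1}) : (#|S| <= t)%N ->
  exists f : {ffun 'I_t -> 'I_n.+1}, S \subset f @: setT.
Proof.
move=> St; exists [ffun i : 'I_t => nth ord0 (enum S) i]; apply/subsetP => x xS.
have xi : (index x (enum S) < t)%N by rewrite (leq_trans _ St) // cardE index_mem mem_enum.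
by apply/imsetP; exists (Ordinal xi) => //; rewrite ffunE nth_index ?mem_enum.
Qed.

Lemma card_bigcup_le (T J : finType) (B : J -> {set T}) :
  (#|\bigcup_j B j| <= \sum_j #|B j|)%N.
Proof.
elim/big_rec2: _ => [|j n S _ le_n]; first by rewrite cards0.
by apply: leq_trans (leq_card_setU _ _) _; rewrite leq_add2l.
Qed.

Section KernelCount.
Variables (R : realType) (h N q : nat).
Implicit Types (U : 'M[R]_(N, q)) (S : {set 'I_N}) (I : {set 'I_h}).

Definition row_supp U : {set 'I_N} := [set i | row i U != 0].

(** Expresses through kernels that, on the columns in [S], the rows of [A] are spanned by those in
    [I]. *)
Definition spans_on (A : 'M[R]_(h, N)) I S :=
  forall U, row_supp U \subset S -> (forall i, i \in I -> row i A *m U = 0) -> A *m U = 0.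

Lemma spans_onS A I I' S : I \subset I' -> spans_on A I S -> spans_on A I' S.
Proof. by move=> /subsetP II' spA U US rU; apply: spA => // i /II'; exact: rU. Qed.

(** A maximal independent set of rows of the column submatrix on [S] works, its rank being at most
    [#|S|]. *)
Lemma exists_spans_on A S : exists2 I : {set 'I_h}, (#|I| <= #|S|)%N & spans_on A I S.
Proof.
pose B := colsub (enum_val : 'I_#|S| -> 'I_N) A; pose f := maxrankfun B.
exists [set f i | i : 'I_(\rank B)].
  by apply: leq_trans (leq_imset_card _ _) _; rewrite card_ord rank_leq_col.
move=> U US rU.
have AB : A *m U = B *m rowsub enum_val U.
  apply/matrixP => i j; rewrite !mxE (bigID (mem S)) /= [X in _ + X]big1 ?addr0 => [|k kS].
    by rewrite big_enum_val; apply: eq_bigr => k _; rewrite !mxE.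
  have: k \notin row_supp U by apply: contra kS; exact/subsetP.
  by rewrite inE negbK => /eqP/rowP/(_ j); rewrite !mxE => ->; rewrite mulr0.
have /submxP[W BW] : (B <= rowsub f B)%MS by rewrite eq_maxrowsub.
rewrite AB BW -mulmxA; suff -> : rowsub f B *m rowsub enum_val U = 0 by rewrite mulmx0.
apply/row_matrixP => i; rewrite row_mul row_rowsub -row_mul -AB row_mul row0.
by apply: rU; apply/imsetP; exists i.
Qed.

Variable good : 'M[R]_(N, q) -> Prop.

Definition has_good_ker S (A : 'M[R]_(h, N)) :=
  exists U, [/\ good U, row_supp U \subset S & A *m U = 0].

Lemma row_pm1_mx (M : 'M[bool]_(h, N)) i : row i (pm1_mx R M) = pm1_mx R (row i M).
Proof. by apply/rowP => j; rewrite !mxE. Qed.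

(* The rows in [I] determine some good [U] killed by the whole matrix, so each
   row outside [I] is confined to [orth_signs U]. *)
Lemma card_spanned_good_ker I S K :
  (forall U, good U -> #|orth_signs U| <= K)%N ->
  (#|[set M | `[< has_good_ker S (pm1_mx R M) /\ spans_on (pm1_mx R M) I S >]]|
     <= (2 ^ N) ^ #|I| * K ^ (h - #|I|))%N.
Proof.
move=> leK; set B := [set _ | _].
(* [rho] forgets the rows outside [I]. The count is bounded by the number of its values times the
   largest fiber. *)
pose rho (M : 'M[bool]_(h, N)) := \matrix_(i, j) ((i \in I) && M i j).
have cI : #|~: I| = (h - #|I|)%N by rewrite cardsCs setCK card_ord.
have prodE (a b : nat) : (\prod_(i < h) (if i \in I then a else b) = a ^ #|I| * b ^ (h - #|I|))%N.
  rewrite (bigID (mem I)) /=; congr muln.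
    by rewrite (eq_bigr (fun=> a)) ?prod_nat_const // => i ->.
  rewrite (eq_bigr (fun=> b)) => [|i /negbTE-> //]; rewrite -cI -prod_nat_const.
  by apply: eq_bigl => i; rewrite inE.
rewrite -sum1_card (partition_big_imset rho) /=.
have fiber_le M0 : M0 \in B -> (\sum_(M in B | rho M == rho M0) 1 <= K ^ (h - #|I|))%N.
  rewrite inE => /asboolP[[U [gU US M0U]] _].
  pose A i := if i \in I then [set row i M0] else orth_signs U.
  rewrite sum1dep_card; apply: (@leq_trans (\prod_i #|A i|)); last first.
    have -> : (K ^ (h - #|I|) = \prod_(i < h) (if i \in I then 1 else K))%N.
      by rewrite prodE exp1n mul1n.
    apply: leq_prod => i _.
    by rewrite /A; case: ifP => _; rewrite ?cards1 ?leK.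
  apply: leq_trans (card_mx_rows_le A); apply/subset_leq_card/subsetP => M.
  rewrite !inE => /andP[/asboolP[_ spM] /eqP/matrixP eqM].
  have rI i : i \in I -> row i M = row i M0.
    by move=> iI; apply/rowP => j; have := eqM i j; rewrite !mxE iI.
  (* [U] comes from [M0] alone, but [M] shares the rows in [I], and these determine whether [M]
     kills [U]. *)
  have MU : pm1_mx R M *m U = 0.
    by apply: spM => // i iI; rewrite row_pm1_mx rI // -row_pm1_mx -row_mul M0U row0.
  apply/forallP => i; rewrite /A; case: ifP => iI; first by rewrite inE rI.
  by rewrite inE -row_pm1_mx -row_mul MU row0.
apply: (@leq_trans (\sum_(Y in rho @: B) K ^ (h - #|I|))).
  by apply: leq_sum => _ /imsetP[M0 M0B ->]; exact: fiber_le.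
rewrite sum_nat_const leq_mul2r; apply/orP; right.
pose A i : {set 'rV[bool]_N} := if i \in I then setT else [set const_mx false].
apply: (@leq_trans (\prod_i #|A i|)); last first.
  have -> : ((2 ^ N) ^ #|I| = \prod_(i < h) (if i \in I then 2 ^ N else 1))%N.
    by rewrite prodE exp1n muln1.
  apply: leq_prod => i _.
  by rewrite /A; case: ifP => _; rewrite ?cards1 // cardsT card_mx card_bool mul1n.
apply: leq_trans (card_mx_rows_le A); apply/subset_leq_card/subsetP => _ /imsetP[M _ ->].
rewrite inE; apply/forallP => i; rewrite /A; case: ifP => iI; first by rewrite inE.
by rewrite inE; apply/eqP/rowP => j; rewrite !mxE iI.
Qed.

End KernelCount.

Lemma card_good_ker_le (R : realType) (h N q t K : nat) (good : 'M[R]_(N, q) -> Prop) :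
  (0 < h)%N -> (0 < N)%N -> (t <= h)%N -> (K <= 2 ^ N)%N ->
  (forall U, good U -> #|row_supp U| <= t)%N ->
  (forall U, good U -> #|orth_signs U| <= K)%N ->
  (#|[set M : 'M[bool]_(h, N) | `[< exists2 U, good U & (pm1_mx R M *m U = 0)%R >]]|
    <= N ^ t * h ^ t * ((2 ^ N) ^ t * K ^ (h - t)))%N.
Proof.
case: h => // h; case: N good => // N good _ _ th KN supt leK.
pose B (fg : {ffun 'I_t -> 'I_h.+1} * {ffun 'I_t -> 'I_N.+1}) :=
  [set M : 'M[bool]_(h.+1, N.+1) | `[< has_good_ker good (fg.2 @: setT) (pm1_mx R M) /\
     spans_on q (pm1_mx R M) (fg.1 @: setT) (fg.2 @: setT) >]].
have card_im (T : finType) (f : {ffun 'I_t -> T}) : (#|f @: setT| <= t)%N.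
  by apply: leq_trans (leq_imset_card _ _) _; rewrite cardsT card_ord.
apply: (@leq_trans #|\bigcup_fg B fg|).
  apply/subset_leq_card/subsetP => M; rewrite inE => /asboolP[U gU MU].
  have [g Sg] := subset_imset_ord (supt _ gU).
  have [I Ig spI] := @exists_spans_on R h.+1 N.+1 q (pm1_mx R M) (g @: setT).
  have [f If] := subset_imset_ord (leq_trans Ig (card_im _ g)).
  apply/bigcupP; exists (f, g) => //; rewrite inE; apply/asboolP; split; first by exists U.
  exact: spans_onS If spI.
have -> : (N.+1 ^ t * h.+1 ^ t = #|{: {ffun 'I_t -> 'I_h.+1} * {ffun 'I_t -> 'I_N.+1}}|)%N.
  by rewrite card_prod !card_ffun !card_ord mulnC.
apply: leq_trans (card_bigcup_le _) _; rewrite -sum_nat_const.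
apply: leq_sum => -[f g] _; apply: leq_trans (card_spanned_good_ker _ _ leK) _ => /=.
set i := #|_|; have it : (i <= t)%N := card_im _ f.
(* The image may have [i < t] rows; as [K <= 2 ^ N], the [t - i] surplus factors [K] may be raised
   to [2 ^ N]. *)
rewrite -(subnKC it) expnD -mulnA leq_mul2l; apply/orP; right.
have -> : (h.+1 - i = (t - i) + (h.+1 - (i + (t - i))))%N by lia.
rewrite expnD leq_mul2r; apply/orP; right.
by case: (t - i)%N => // e; rewrite leq_exp2r.
Qed.

(** * Planes in which every nonzero vector has large support *)

Section Spread.
Variables (R : realType) (N : nat).

(** The plane is the column space of [U]; [1 + 1] is the column type of [row_mx u1 u2]. *)
Definition spread m (U : 'M[R]_(N, 1 + 1)) :=
  #|row_supp U| = m /\ forall c : 'cV[R]_(1 + 1), c != 0 -> (m <= 2 * #|row_supp (U *m c)|)%N.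

Lemma ord2P (P : 'I_(1 + 1) -> Prop) : P ord0 -> P ord_max -> forall i, P i.
Proof.
move=> P0 P1 [[|[|i]] lti] //.
  by have -> : Ordinal lti = ord0 by apply: val_inj.
by have -> : Ordinal lti = ord_max by apply: val_inj.
Qed.

Lemma mulmx2E (U : 'M[R]_(N, 1 + 1)) (c : 'cV[R]_(1 + 1)) i j :
  (U *m c) i j = U i ord0 * c ord0 ord0 + U i ord_max * c ord_max ord0.
Proof.
rewrite mxE big_ord_recl big_ord1 [j]ord1.
by have -> : lift ord0 ord0 = ord_max :> 'I_(1 + 1) by apply: val_inj.
Qed.

(* Greedily pair up coordinates with independent rows; the leftover rows are all
   proportional, so some combination of the columns vanishes on all of them. *)
Lemma card_orth_signs_spread m (U : 'M[R]_(N, 1 + 1)) : spread m U -> (4 < m)%N ->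
  (#|orth_signs U| * m <= 8 * 2 ^ N)%N.
Proof.
(* [D i j] is the minor of rows [i] and [j], so [e] is their linear independence. *)
move=> [szU spU] m4; pose D i j := U i ord0 * U j ord_max - U i ord_max * U j ord0.
pose e i j := D i j != 0.
have DN i j : D j i = - D i j by rewrite /D opprB mulrC [U j ord_max * _]mulrC.
have sym_e : symmetric e by move=> i j; rewrite /e DN oppr_eq0.
have irr_e : irreflexive e by move=> i; rewrite /e /D mulrC subrr eqxx.
have [ps [r [eqs eps er]]] := greedy_pairing (enum (row_supp U)) sym_e irr_e.
have us : uniq (flatten [seq [:: p.1; p.2] | p <- ps] ++ r).
  by rewrite -(perm_uniq eqs) enum_uniq.
have szs : (2 * size ps + size r = m)%N.
  rewrite -szU cardE (perm_size eqs) size_cat; congr addn.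
  by elim: (ps) => //= p l <-; rewrite mulnS.
have ler : (2 * size r <= m)%N.
  case er0: r => [|r0 r'] //=; rewrite -/(size (r0 :: r')) -er0.
  have r0r : r0 \in r by rewrite er0 mem_head.
  (* Entry [i] of [U *m c] is the minor [D i r0], which vanishes on [r]. So its support misses [r],
     and spreading gives [m <= 2 (m - size r)]. *)
  pose c : 'cV[R]_(1 + 1) := \col_j (if j == ord0 then U r0 ord_max else - U r0 ord0).
  have UcE i : (U *m c) i ord0 = D i r0 by rewrite mulmx2E !mxE /= mulrN.
  have memr i : i \in r -> i \in row_supp U.
    by move=> ir; rewrite -mem_enum (perm_mem eqs) mem_cat ir orbT.
  have c0 : c != 0.
    have := memr _ r0r; rewrite inE; apply: contra => /eqP/colP c0; apply/eqP/rowP.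
    apply: ord2P; rewrite !mxE.
      by have := c0 ord_max; rewrite !mxE /= => /eqP; rewrite oppr_eq0 => /eqP.
    by have := c0 ord0; rewrite !mxE.
  have ur : uniq r by move: us; rewrite cat_uniq => /and3P[].
  have := spU _ c0; suff: (#|row_supp (U *m c)| + size r <= m)%N by lia.
  rewrite -szU -(cardsID [set i in r] (row_supp U)) addnC leq_add //.
    rewrite -(card_uniqP ur) subset_leq_card //; apply/subsetP => i ir.
    by rewrite !inE ir andbT; have := memr _ ir; rewrite inE.
  apply/subset_leq_card/subsetP => i; rewrite !inE => /eqP/rowP Uci; apply/andP; split.
    apply/negP => ir; apply: Uci => j; rewrite [j]ord1 mxE [RHS]mxE UcE.
    by apply/eqP; rewrite -[_ == _]negbK; exact: er.
  apply/negP => /eqP/rowP Ui; apply: Uci => j; rewrite mxE [RHS]mxE mulmx2E.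
  by have := Ui ord0; have := Ui ord_max; rewrite !mxE => -> ->; rewrite !mul0r addr0.
(* The pairs cover at least [m / 2] coordinates, so there are at least [m / 4 > 1] of them. *)
have np : (1 < size ps)%N by lia.
suff: (#|orth_signs U| * size ps <= 2 * 2 ^ N)%N by nia.
apply: card_orth_signs_pairs => // [|p /eps].
  by move: us; rewrite cat_uniq => /and3P[].
move: p => [i j] /=; rewrite /e /D => Dn0; split.
- apply: contra Dn0 => /eqP/rowP U0; have := U0 ord0; have := U0 ord_max; rewrite !mxE => -> ->.
  by rewrite !mul0r subrr.
- apply: contra Dn0 => /eqP/rowP U0; have := U0 ord0; have := U0 ord_max; rewrite !mxE => -> ->.
  by rewrite !mulr0 subrr.
- move=> a b /rowP ab; have := ab ord0; have := ab ord_max; rewrite !mxE => e1 e0.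
  have: a * (U i ord0 * U j ord_max - U i ord_max * U j ord0) == 0.
    by apply/eqP; rewrite mulrBr !mulrA e0 e1; ring.
  by rewrite mulf_eq0 (negbTE Dn0) orbF => /eqP->; rewrite scale0r.
Qed.

End Spread.

(** * Kernel events and the union bound *)

Section Events.
Variables (R : realType) (h N : nat).

Definition ker_event q (good : 'M[R]_(N, q) -> Prop) : {set 'M[bool]_(h, N)} :=
  [set M | `[< exists2 U, good U & pm1_mx R M *m U = 0 >]].

Lemma card_ker_event_le q t (p : R) (good : 'M[R]_(N, q) -> Prop) :
  (0 < h)%N -> (0 < N)%N -> (t <= h)%N -> 0 <= p <= 1 ->
  (forall U, good U -> #|row_supp U| <= t)%N ->
  (forall U, good U -> #|orth_signs U|%:R <= p * 2 ^+ N) ->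
  #|ker_event good|%:R <= (N * h)%:R ^+ t * p ^+ (h - t) * (2 ^ (h * N))%:R.
Proof.
move=> h0 N0 th /andP[p0 p1] supt le_p; set K := Num.truncn (p * 2 ^+ N).
have pN0 : 0 <= p * 2 ^+ N by rewrite mulr_ge0 ?exprn_ge0.
have /andP[Kle Klt] := truncn_itv pN0.
have KN : (K <= 2 ^ N)%N.
  by rewrite -(ler_nat R) (le_trans Kle) // natrX ler_piMl ?exprn_ge0.
have leK U : good U -> (#|orth_signs U| <= K)%N.
  by move=> /le_p; rewrite -ltnS -(ltr_nat R) => /le_lt_trans; apply.
have := card_good_ker_le h0 N0 th KN supt leK; rewrite -/(ker_event good) -(ler_nat R).
move=> /le_trans; apply; rewrite -expnMn natrM natrX -mulrA ler_wpM2l ?exprn_ge0 ?ler0n //.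
have -> : (2 ^ (h * N) = (2 ^ N) ^ t * (2 ^ N) ^ (h - t))%N.
  by rewrite -expnD subnKC // -expnM mulnC.
rewrite !natrM mulrCA ler_wpM2l ?ler0n // !(natrX _ _ (h - t)) -exprMn.
by rewrite lerXn2r // ?nnegrE ?ler0n ?natrX.
Qed.

Lemma row_supp1 (u : 'cV[R]_N) : row_supp u = supp u.
Proof.
apply/setP => i; rewrite !inE; congr negb; apply/eqP/eqP => [/rowP/(_ ord0)|ui].
  by rewrite !mxE.
by apply/rowP => j; rewrite [j]ord1 !mxE.
Qed.

Lemma row_supp_row_mx (u1 u2 : 'cV[R]_N) :
  row_supp (row_mx u1 u2) = supp u1 :|: supp u2.
Proof.
apply/setP => i; rewrite -!row_supp1 !inE -negb_and; congr negb.
by rewrite row_row_mx -{1}(row_mx0 R 1 1 1); apply/eqP/andP => [/eq_row_mx[-> ->]|[/eqP-> /eqP->]].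
Qed.

(** If [u1], [u2] violate the bound, either some nonzero combination has support below [D], or their
    joint support [m] lies in [[D, 2D)] and every nonzero combination has support at least
    [D > m / 2], so the plane is spread. All sizes are below [h], leaving [2h] events. *)
Lemma prob_d2_ge_lower (D beta : R) : 0 < D -> 2 * D <= h%:R -> 0 <= beta ->
  (forall t, (0 < t)%N -> t%:R < D ->
     #|ker_event (fun u : 'cV[R]_N => #|row_supp u| = t)|%:R <= beta * (2 ^ (h * N))%:R) ->
  (forall m, D <= m%:R -> m%:R < 2 * D ->
     #|ker_event (spread m)|%:R <= beta * (2 ^ (h * N))%:R) ->
  1 - 2 * h%:R * beta <= prob_d2_ge h N (2 * D).
Proof.
move=> D0 Dh b0 le1 le2; rewrite /prob_d2_ge; set G := [set _ | _].
have T0 : 0 < (2 ^ (h * N))%:R :> R by rewrite ltr0n expn_gt0.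
rewrite ler_pdivlMr // mulrBl mul1r lerBlDr.
pose B (j : bool * 'I_h) : {set 'M[bool]_(h, N)} :=
  if j.1 then
    if (0 < j.2)%N && (j.2%:R < D) then ker_event (fun u : 'cV[R]_N => #|row_supp u| = j.2) else set0
  else if (D <= j.2%:R) && (j.2%:R < 2 * D) then ker_event (@spread R N j.2) else set0.
have GB : ~: G \subset \bigcup_j B j.
  apply/subsetP => M; rewrite !inE => /asboolPn nd2.
  have /existsNP[u1 /existsNP[u2 +]] := nd2.
  move=> /not_implyP[k1 /not_implyP[k2 /not_implyP[ind /negP]]]; rewrite -ltNge => lt2D.
  pose U := row_mx u1 u2.
  have MU : pm1_mx R M *m U = 0 by rewrite mul_mx_row k1 k2 row_mx0.
  have ltm (m : nat) : m%:R < 2 * D -> (m < h)%N.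
    by move=> mD; rewrite -(ltr_nat R) (lt_le_trans mD).
  have Uc (c : 'cV[R]_(1 + 1)) : U *m c = 0 -> c = 0.
    rewrite -[c]vsubmxK mul_row_col [usubmx c]mx11_scalar [dsubmx c]mx11_scalar !mul_mx_scalar.
    move=> /ind[-> ->]; by rewrite -scalemx1 !scale0r col_mx0.
  have Ucn0 (c : 'cV[R]_(1 + 1)) : c != 0 -> (0 < #|row_supp (U *m c)|)%N.
    move=> c0; rewrite card_gt0; apply: contra c0 => /eqP/setP supp0.
    apply/eqP; apply: Uc; apply/row_matrixP => i; have := supp0 i; rewrite !inE row0 => /negbT.
    by rewrite negbK => /eqP.
  have [[c [c0 cD]]|nc] := pselect (exists c : 'cV[R]_(1 + 1), c != 0 /\ #|row_supp (U *m c)|%:R < D).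
    have ch : (#|row_supp (U *m c)| < h)%N by apply: ltm; lra.
    apply/bigcupP; exists (true, Ordinal ch) => //; rewrite /B /= cD Ucn0 //= inE.
    by apply/asboolP; exists (U *m c) => //; rewrite mulmxA MU mul0mx.
  have {}nc (c : 'cV[R]_(1 + 1)) : c != 0 -> D <= #|row_supp (U *m c)|%:R.
    by move=> c0; rewrite leNgt; apply/negP => cD; apply: nc; exists c.
  have mE : #|row_supp U| = #|supp u1 :|: supp u2| by rewrite row_supp_row_mx.
  have mD : #|row_supp U|%:R < 2 * D by rewrite mE.
  apply/bigcupP; exists (false, Ordinal (ltm _ mD)) => //; rewrite /B /= mD andbT ifT; last first.
    have c0 : (delta_mx ord0 ord0 : 'cV[R]_(1 + 1)) != 0.
      by apply/eqP => /colP/(_ ord0)/eqP; rewrite !mxE eqxx oner_eq0.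
    apply: le_trans (nc _ c0) _; rewrite ler_nat; apply/subset_leq_card/subsetP => i.
    by rewrite !inE row_mul; apply: contra => /eqP->; rewrite mul0mx.
  rewrite inE; apply/asboolP; exists U => //; split=> // c /nc Dc.
  by rewrite -(ler_nat R) natrM; lra.
have card_le : #|~: G|%:R <= 2 * h%:R * (beta * (2 ^ (h * N))%:R).
  apply: (@le_trans _ _ (\sum_j #|B j|)%:R).
    by rewrite ler_nat (leq_trans _ (card_bigcup_le _)) ?subset_leq_card.
  have -> : 2 * h%:R * (beta * (2 ^ (h * N))%:R) =
      \sum_(j : bool * 'I_h) beta * (2 ^ (h * N))%:R.
    by rewrite sumr_const card_prod card_bool card_ord -[RHS]mulr_natl natrM.
  rewrite natr_sum; apply: ler_sum => -[b t] _; rewrite /B /=.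
  have bT0 : 0 <= beta * (2 ^ (h * N))%:R by rewrite mulr_ge0 ?ler0n.
  case: b => /=; case: ifP => [/andP[t0 tD]|_]; rewrite ?cards0 //.
    exact: le1.
  exact: le2.
have eqT : (2 ^ (h * N))%:R = #|G|%:R + #|~: G|%:R :> R.
  by rewrite -natrD cardsC card_mx card_bool.
by rewrite {1}eqT lerD2l (le_trans card_le) // mulrA.
Qed.

Lemma orth_signs_le_half (u : 'cV[R]_N) : (0 < #|row_supp u|)%N ->
  #|orth_signs u|%:R <= 2^-1 * 2 ^+ N :> R.
Proof.
move=> /card_gt0P[i]; rewrite inE => /card_orth_signs_half.
by rewrite -(ler_nat R) natrM natrX; lra.
Qed.

Lemma orth_signs_le_sqrt (u : 'cV[R]_N) t : (1 < t)%N -> #|row_supp u| = t ->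
  #|orth_signs u|%:R <= Num.sqrt (2 / t%:R) * 2 ^+ N :> R.
Proof.
move=> t1 ut; have := @card_orth_signs_single R N 1 u (enum (row_supp u)) (enum_uniq _).
rewrite -cardE ut => /(_ t1) le2.
have {le2} : (#|orth_signs u| ^ 2 * t <= 2 * 4 ^ N)%N.
  by apply: le2 => i; rewrite mem_enum inE.
rewrite -(ler_nat R) !natrM !natrX => le2; have t0 : 0 < t%:R :> R by rewrite ltr0n; lia.
rewrite -ler_sqr ?nnegrE ?mulr_ge0 ?sqrtr_ge0 ?exprn_ge0 ?ler0n //.
rewrite exprMn sqr_sqrtr ?divr_ge0 ?ler0n // -exprM mulnC exprM mulrAC ler_pdivlMr //.
by have -> : (2 ^+ 2 : R) = 4 by ring.
Qed.

Lemma orth_signs_le_spread m (U : 'M[R]_(N, 1 + 1)) : (4 < m)%N -> spread m U ->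
  #|orth_signs U|%:R <= 8 / m%:R * 2 ^+ N :> R.
Proof.
move=> m4 /card_orth_signs_spread/(_ m4); rewrite -(ler_nat R) !natrM natrX => le8.
have m0 : 0 < m%:R :> R by rewrite ltr0n; lia.
by rewrite mulrAC ler_pdivlMr.
Qed.

End Events.

(** * Logarithmic estimates *)

Section Estimates.
Variable R : realType.
Implicit Types (a d delta eps h t x y C K L LN : R).

Lemma ln_le_sub1 y : 0 < y -> ln y <= y - 1.
Proof.
move=> y0; have: ln (1 + (y - 1)) <= y - 1 by apply: le_ln1Dx; lra.
by rewrite addrC subrK.
Qed.

Lemma ln_le_linear a y : 0 < a -> 0 < y -> ln y <= a * y - 1 - ln a.
Proof.
move=> a0 y0; have := ln_le_sub1 (mulr_gt0 a0 y0).
rewrite lnM ?posrE //; lra.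
Qed.

(** The target [h ^- 2] beats the [2h] events of the union bound. *)
Lemma ler_expR_ln (N h t : nat) (p : R) : (0 < N)%N -> (0 < h)%N -> (t <= h)%N -> 0 < p ->
  t%:R * (ln N%:R + ln h%:R) + (h%:R - t%:R) * ln p <= - (2 * ln h%:R) ->
  (N * h)%:R ^+ t * p ^+ (h - t) <= h%:R ^- 2.
Proof.
move=> N0 h0 th p0 le_ln.
have Nr : 0 < N%:R :> R by rewrite ltr0n.
have hr : 0 < h%:R :> R by rewrite ltr0n.
rewrite -ler_ln ?posrE ?invr_gt0 ?exprn_gt0 ?mulr_gt0 ?exprn_gt0 ?ltr0n ?muln_gt0 ?N0 //.
rewrite lnM ?posrE ?exprn_gt0 ?ltr0n ?muln_gt0 ?N0 // lnV ?posrE ?exprn_gt0 //.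
rewrite !lnXn ?ltr0n ?muln_gt0 ?N0 // natrM lnM ?posrE //.
by move: le_ln; rewrite -natrB // !mulr_natl.
Qed.

(** Here and below [L] and [LN] stand for [ln h] and [ln N]; [x] stands for [ln d]. *)
Lemma ln_N_bound d h x L LN : 0 < d -> 0 < h -> x <= L ->
  d * (LN - x) <= h * x / 2 -> d * (LN - L) <= h * L / 2.
Proof. by move=> d0 h0 xL; nra. Qed.

Lemma mul_ln_N_bound d h L LN t theta : 0 < d -> 0 < h -> 0 < L -> 0 <= t -> t <= theta * d ->
  d * (LN - L) <= h * L / 2 -> t * (LN - L) <= theta * (h * L) / 2.
Proof.
move=> d0 h0 L0 t0 td dN; rewrite -(ler_pM2l d0).
have hL : 0 <= h * L by rewrite mulr_ge0 // ltW.
have := ler_wpM2l t0 dN; have := ler_wpM2r hL td; nra.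
Qed.

(** Small supports. The bound on [N] gives [LN + L <= K * L], so the choice of support and rows
    costs at most [h / 10], while at least [h / 2] rows contribute [- 1 / 2] each. *)
Lemma half_estimate d delta h t L LN K : 0 < delta -> delta <= 48^-1 -> 0 < h ->
  delta * h <= d -> d <= 2 * (delta * h) -> 0 < L -> 0 <= t -> t <= d ->
  K = 2 + (2 * delta)^-1 -> d * (LN - L) <= h * L / 2 ->
  t * (K * L) <= h / 10 -> 20 * L <= h ->
  t * (LN + L) + (h - t) * ln 2^-1 <= - (2 * L).
Proof.
move=> de0 de1 h0 dd d2 L0 t0 td KE dN tK Lh.
have d0 : 0 < d by apply: lt_le_trans dd; rewrite mulr_gt0.
have LK : LN + L <= K * L.
  rewrite -(ler_pM2l d0) KE mulrDl [d * (2 * L + _)]mulrDr.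
  have -> : d * ((2 * delta)^-1 * L) = (d / delta) * (L / 2) by field; apply: lt0r_neq0.
  have : h * (L / 2) <= (d / delta) * (L / 2).
    by rewrite ler_wpM2r ?ler_pdivlMr // 1?mulrC //; lra.
  by nra.
have := ler_wpM2l t0 LK.
have ln2 : ln 2^-1 <= - 2^-1 :> R.
  by have := @ln_le_sub1 2^-1; lra.
have th : h / 2 <= h - t by nra.
have : (h - t) * ln 2^-1 <= (h / 2) * - 2^-1 by nra.
nra.
Qed.

(** To leading order the cost is [(1 - eps) h L / 2] and the gain [h L / 2]. The surplus
    [eps h L / 2] absorbs the errors, those of order [delta h L] because [delta <= eps / 48]. *)
Lemma sqrt_estimate d delta eps h t L LN C lt : 0 < delta -> delta <= 48^-1 * eps -> eps < 1 ->
  0 < h -> d <= 2 * (delta * h) -> 0 < d -> 0 < L -> 0 <= t -> t <= (1 - eps) * d ->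
  d * (LN - L) <= h * L / 2 -> 0 <= C -> (1 - eps / 16) * L - C <= lt ->
  4 * C <= eps * L -> 16 <= eps * h ->
  t * (LN + L) + (h - t) * (- lt / 2) <= - (2 * L).
Proof.
move=> de0 de1 e1 h0 d2 d0 L0 t0 td dN C0 lt_ge CL eh.
have e0 : 0 < eps by lra.
have := mul_ln_N_bound d0 h0 L0 t0 td dN.
have hL : 0 <= h * L by rewrite mulr_ge0 // ltW.
have tdh : t <= 2 * (delta * h) by nra.
have th : 0 <= h - t by nra.
have := ler_wpM2l th lt_ge.
have := ler_wpM2r (ltW L0) tdh.
have : t * C >= 0 by nra.
have := ler_wpM2l (ltW h0) CL.
have := ler_wpM2r (ltW L0) eh.
have := ler_wpM2r hL de1.
have : 0 <= t * (L * eps) by rewrite !mulr_ge0 // ltW.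
nra.
Qed.

(** The support may be twice as large as for a single vector, but the row probability is of order
    [1 / t], not [1 / sqrt t]: cost and gain both double. *)
Lemma spread_estimate d delta eps h t L LN C lt : 0 < delta -> delta <= 48^-1 * eps -> eps < 1 ->
  0 < h -> d <= 2 * (delta * h) -> 0 < d -> 0 < L -> 0 <= t -> t <= 2 * (1 - eps) * d ->
  d * (LN - L) <= h * L / 2 -> 0 <= C -> L - C <= lt ->
  4 * C <= eps * L -> 16 <= eps * h ->
  t * (LN + L) + (h - t) * (- lt) <= - (2 * L).
Proof.
move=> de0 de1 e1 h0 d2 d0 L0 t0 td dN C0 lt_ge CL eh.
have e0 : 0 < eps by lra.
have := mul_ln_N_bound d0 h0 L0 t0 td dN.
have hL : 0 <= h * L by rewrite mulr_ge0 // ltW.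
have tdh : t <= 4 * (delta * h) by nra.
have th : 0 <= h - t by nra.
have := ler_wpM2l th lt_ge.
have := ler_wpM2r (ltW L0) tdh.
have : t * C >= 0 by nra.
have := ler_wpM2l (ltW h0) CL.
have := ler_wpM2r (ltW L0) eh.
have := ler_wpM2r hL de1.
nra.
Qed.

Lemma nat_eventually_ge (s : seq R) :
  exists H : nat, forall h : nat, (H <= h)%N -> forall x, x \in s -> x <= h%:R.
Proof.
elim: s => [|x s [H HP]]; first by exists 0%N.
exists (maxn H (Num.bound x)) => h; rewrite geq_max => /andP[Hh xh] y.
rewrite inE => /predU1P[->|/HP]; last exact.
have [x0|x0] := leP 0 x; last by rewrite (le_trans (ltW x0)).
by rewrite (le_trans (ltW (archi_boundP x0))) // ler_nat.
Qed.

End Estimates.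

(** * The parameters [d] and [N], and the final assembly *)

Lemma ceil_bounds (R : realType) (x : R) (d : nat) : (d : int) = Num.ceil x -> 1 <= x ->
  x <= d%:R /\ d%:R <= 2 * x.
Proof.
move=> dE x1; have /andP[] := ceil_itv x; rewrite -dE intrB -pmulrn => lo hi.
by split; [exact: hi|lra].
Qed.

Lemma largest_N_ln (R : realType) (h d N : nat) : (1 < d)%N -> largest_N R h d N ->
  d%:R * (ln N%:R - ln d%:R) <= h%:R * ln d%:R / 2 :> R.
Proof.
move=> d1 [N0 + _]; rewrite /logb.
have d0 : 0 < d%:R :> R by rewrite ltr0n; lia.
have N0r : 0 < N%:R :> R by rewrite ltr0n.
have lnd : 0 < ln d%:R :> R by rewrite ln_gt0 // ltr1n.
have -> : ln (Num.sqrt d%:R) = ln d%:R / 2 :> R.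
  have := @lnXn R 2 (Num.sqrt d%:R); rewrite sqr_sqrtr ?ler0n // sqrtr_gt0 => /(_ d0) e2.
  by lra.
rewrite ln_div ?posrE // mulrA ler_pdivrMr ?divr_gt0 //.
by rewrite mulrA.
Qed.

Theorem theorem5p1 (R : realType) :
  exists c2 : R, 0 < c2 /\
  forall eps delta : R, 0 < eps -> eps < 1 -> 0 < delta -> delta <= c2 * eps ->
  forall eta : R, 0 < eta ->
  exists H : nat, forall h : nat, (H <= h)%N ->
  forall d N : nat, (d : int) = Num.ceil (delta * h%:R) -> @largest_N R h d N ->
    1 - eta <= @prob_d2_ge R h N (2 * (1 - eps) * d%:R).
Proof.
exists 48^-1; split=> [|eps delta e0 e1 de0 de1 eta eta0]; first lra.
pose K : R := 2 + (2 * delta)^-1; pose C1 := `|ln (10 * K) - ln (eps / 16)|.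
pose C2 := `|7 - ln ((1 - eps) * delta)|.
have K2 : 2 <= K by rewrite lerDl invr_ge0; lra.
(* In order, these give: [ln h > 0], [d > 1], [eps h >= 16], [D >= 9], [2 / h <= eta], that [C1] and
   [C2] are at most [eps L / 4], and [10 K L <= h]. *)
have [H HP] := nat_eventually_ge [:: 2; 2 / delta; 16 / eps; 9 / ((1 - eps) * delta); 2 / eta;
  sequences.expR (4 * C1 / eps); sequences.expR (4 * C2 / eps); 20 * K * (- 1 - ln (20 * K)^-1)].
exists H => h /HP {HP}-Hh d N dE lN.
have h2 : 2 <= h%:R :> R by apply: Hh; exact: mem_head.
have h0 : 0 < h%:R :> R by lra.
have hn0 : (0 < h)%N by rewrite -(ltr0n R).
have h_delta : 2 <= delta * h%:R by rewrite mulrC -ler_pdivrMr // Hh // !inE eqxx ?orbT.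
have h_eps : 16 <= eps * h%:R by rewrite mulrC -ler_pdivrMr // Hh // !inE eqxx ?orbT.
have ed0 : 0 < (1 - eps) * delta by rewrite mulr_gt0 //; lra.
have h_ed : 9 <= (1 - eps) * delta * h%:R.
  by rewrite mulrC -ler_pdivrMr // Hh // !inE eqxx ?orbT.
have h_eta : 2 <= eta * h%:R by rewrite mulrC -ler_pdivrMr // Hh // !inE eqxx ?orbT.
set L : R := ln h%:R.
have L0 : 0 < L by rewrite ln_gt0; lra.
have L_C1 : 4 * C1 <= eps * L.
  rewrite -ler_pdivrMl // mulrC -(expRK (4 * C1 / eps)) ler_ln ?posrE ?expR_gt0 //.
  by rewrite Hh // !inE eqxx ?orbT.
have L_C2 : 4 * C2 <= eps * L.
  rewrite -ler_pdivrMl // mulrC -(expRK (4 * C2 / eps)) ler_ln ?posrE ?expR_gt0 //.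
  by rewrite Hh // !inE eqxx ?orbT.
have LK : 10 * K * L <= h%:R.
  have K0 : 0 < 20 * K by lra.
  have := ln_le_linear (a := (20 * K)^-1) _ h0; rewrite invr_gt0 => /(_ K0).
  rewrite -/L -(ler_pM2l K0) !mulrBr mulrA divff ?lt0r_neq0 // mul1r => le1.
  have : 20 * K * (- 1 - ln (20 * K)^-1) <= h%:R by rewrite Hh // !inE eqxx ?orbT.
  by rewrite mulrBr; lra.
have L20 : 20 * L <= h%:R by have := ler_wpM2r (ltW L0) K2; lra.
have x1 : 1 <= delta * h%:R by lra.
have [dge dle] := ceil_bounds dE x1.
have d1 : (1 < d)%N by rewrite -(ltr_nat R); lra.
have dr0 : 0 < d%:R :> R by lra.
have de48 : delta <= 48^-1 by lra.
have dh : d%:R <= h%:R / 24 :> R by have := ler_wpM2r (ltW h0) de48; lra.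
have dN : d%:R * (ln N%:R - L) <= h%:R * L / 2.
  apply: ln_N_bound (largest_N_ln d1 lN) => //.
  by rewrite ler_ln ?posrE //; lra.
have N0 : (0 < N)%N by case: lN.
set D : R := (1 - eps) * d%:R.
have Dd : D <= d%:R by rewrite /D; nra.
have D9 : 9 <= D by rewrite (le_trans h_ed) // -mulrA ler_wpM2l //; lra.
apply: (@le_trans _ _ (1 - 2 * h%:R * h%:R ^- 2)).
  have -> : 2 * h%:R * h%:R ^- 2 = 2 / h%:R :> R by field; apply: lt0r_neq0.
  by rewrite lerD2l lerN2 ler_pdivrMr.
rewrite -[2 * (1 - eps) * _]mulrA -/D; apply: prob_d2_ge_lower.
- lra.
- lra.
- by rewrite invr_ge0 exprn_ge0 // ltW.
- move=> t t0 tD; have th : (t <= h)%N by rewrite -(ler_nat R); lra.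
  (* Below [h / (10 K L)] the row probability [1 / 2] suffices; above it, [ln t] is close to [L]. *)
  have [tK|tK] := leP (t%:R * (K * L)) (h%:R / 10).
    have p1 : 0 <= (2^-1 : R) <= 1 by lra.
    have le_ev := @card_ker_event_le R h N 1 t 2^-1 (fun u => #|row_supp u| = t) hn0 N0 th p1.
    apply: le_trans (le_ev _ _) _ => [U ->|U Ut|] //; first by apply: orth_signs_le_half; rewrite Ut.
    rewrite ler_wpM2r ?ler0n // ler_expR_ln //; first lra.
    apply: (half_estimate (d := d%:R) (delta := delta) (K := K)) => //; lra.
  have t1 : (1 < t)%N.
    by rewrite -(ltr_nat R) -(ltr_pM2r (mulr_gt0 (lt_le_trans (ltr0Sn R 1) K2) L0)); lra.
  have t2 : 2 <= t%:R :> R by rewrite ler_nat.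
  have tr0 : 0 < t%:R :> R by lra.
  have p0 : 0 < 2 / t%:R :> R by rewrite divr_gt0.
  have p1 : 0 <= Num.sqrt (2 / t%:R : R) <= 1.
    by rewrite sqrtr_ge0 -[X in _ <= X]sqrtr1 ler_wsqrtr // ler_pdivrMr ?mul1r.
  have le_ev := @card_ker_event_le R h N 1 t _ (fun u => #|row_supp u| = t) hn0 N0 th p1.
  apply: le_trans (le_ev _ _) _ => [U ->|U Ut|] //; first exact: orth_signs_le_sqrt.
  rewrite ler_wpM2r ?ler0n // ler_expR_ln ?sqrtr_gt0 //.
  have -> : ln (Num.sqrt (2 / t%:R)) = - (ln t%:R - ln 2) / 2 :> R.
    have := @lnXn R 2 (Num.sqrt (2 / t%:R)); rewrite sqr_sqrtr ?(ltW p0) // sqrtr_gt0 => /(_ p0).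
    by rewrite ln_div ?posrE // => e2; lra.
  apply: (sqrt_estimate (d := d%:R) (delta := delta) (eps := eps) (C := C1)) => //.
  + exact: ltW.
  + exact: normr_ge0.
  (* From [t > h / (10 K L)], [ln t] is at least [L - ln (10 K) - ln L], and [ln L] is at most
     [eps L / 16] plus a constant; [C1] collects the constants. *)
  + have KL0 : 0 < 10 * K * L by rewrite !mulr_gt0 //; lra.
    have : ln (h%:R / (10 * K * L)) <= ln t%:R.
      by rewrite ler_ln ?posrE ?divr_gt0 // ler_pdivrMr //; lra.
    rewrite ln_div ?posrE // (lnM (x := 10 * K)) ?posrE //; last by lra.
    have : ln L <= eps / 16 * L - 1 - ln (eps / 16) by apply: ln_le_linear => //; lra.
    have : ln (10 * K) - ln (eps / 16) <= C1 := ler_norm _.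
    have := ln_le_sub1 (ltr0Sn R 1); rewrite -/L; lra.
- move=> m Dm mD; have th : (m <= h)%N by rewrite -(ler_nat R); lra.
  (* [D >= 9] was arranged so that [8 / m] is at most 1. *)
  have m8 : (8 < m)%N by rewrite -(ltr_nat R); lra.
  have mr0 : 0 < m%:R :> R by lra.
  have p1 : 0 <= (8 / m%:R : R) <= 1 by rewrite divr_ge0 ?ler_pdivrMr ?mul1r //; lra.
  apply: le_trans (card_ker_event_le hn0 N0 th p1 _ _) _ => [U [-> _]|U|] //.
    by apply: orth_signs_le_spread; exact: leq_trans m8.
  rewrite ler_wpM2r ?ler0n // ler_expR_ln ?divr_gt0 //.
  have -> : ln (8 / m%:R) = - (ln m%:R - ln 8) :> R by rewrite ln_div ?posrE // opprB.
  apply: (spread_estimate (d := d%:R) (delta := delta) (eps := eps) (C := C2)) => //.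
  + by rewrite -mulrA ltW.
  + exact: normr_ge0.
  + have : ln ((1 - eps) * delta * h%:R) <= ln m%:R.
      rewrite ler_ln ?posrE ?mulr_gt0 //; last by lra.
      by rewrite (le_trans _ Dm) // -mulrA ler_wpM2l //; lra.
    rewrite lnM ?posrE // -/L.
    have : 7 - ln ((1 - eps) * delta) <= C2 := ler_norm _.
    have := ln_le_sub1 (ltr0Sn R 7); lra.
Qed.
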